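(* Let $d\ge 1$, let $\Phi=(\varphi_0,\dots,\varphi_d)\in\mathbb{R}^{d+1}$ be a $Z$-symmetric set of phase factors, and let $u,v,w$ be real polynomials such that for all real $\theta$ $$\mathcal{Q}(\theta,\Phi)=\begin{pmatrix} u(\cos\theta) & -\sin\theta\,w(\cos\theta)+\mathrm{i}v(\cos\theta)\\ \sin\theta\,w(\cos\theta)+\mathrm{i}v(\cos\theta) & u(\cos\theta)\end{pmatrix}.$$ Let $\mathcal{H}$ be a Hermitian operator on the $n$-qubit space $\mathbb{C}^{2^n}$ with $0\prec\mathcal{H}\prec\frac{\pi}{2}I$, and let $\ket{\psi}$ be a unit vector in this space. Let $p_{0\to0}$ and $p_{0\to+}$ be the probabilities that, when the circuit unitary $\mathcal{U}(\mathcal{H},\Phi)$ defined in the context is applied to $\ket{0}\ket{\psi}$, the measurement of the ancilla is projected onto $\ket{0}$ and onto $\ket{+}=(\ket0+\ket1)/\sqrt2$, respectively, i.e. $p_{0\to 0}=\|(\bra{0}\otimes I)\,\mathcal{U}(\mathcal{H},\Phi)\ket{0}\ket{\psi}\|_2^2$ and $p_{0\to +}=\|(\bra{+}\otimes I)\,\mathcal{U}(\mathcal{H},\Phi)\ket{0}\ket{\psi}\|_2^2$. Then $$p_{0\to0}=\bra{\psi}u^2(\cos(\mathcal{H}/2))\ket{\psi}$$ and $$p_{0\to+}=\frac12+\bra{\psi}\sin(\mathcal{H}/2)\,u(\cos(\mathcal{H}/2))\,w(\cos(\mathcal{H}/2))\ket{\psi}.$$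
   Context: $X,Z$ are the Pauli matrices. For $\Phi=(\varphi_0,\dots,\varphi_d)\in\mathbb{R}^{d+1}$ the QSP sequence is $\mathcal{Q}(\theta,\Phi)=e^{\mathrm{i}\varphi_0X}\prod_{j=1}^d\left(e^{\mathrm{i}\theta Z}e^{\mathrm{i}\varphi_jX}\right)$ (product ordered left to right in increasing $j$). $\Phi$ is called $Z$-symmetric if $\varphi_d=\varphi_0+\pi/2$ and $\varphi_j=\varphi_{d-j}$ for $1\le j\le d-1$; for such $\Phi$ polynomials $u,v,w$ as in the claim exist. Circuit: the first tensor factor is one ancilla qubit and the second is the $n$-qubit system. Let $O_{\mathcal{H}}=e^{-\mathrm{i}\mathcal{H}}$ and let $\mathcal{C}=\ket0\bra0\otimes I+\ket1\bra1\otimes O_{\mathcal{H}}$ be the controlled time evolution. The circuit applies $e^{\mathrm{i}\varphi_dX}$ to the ancilla, then $\mathcal{C}$, then $e^{\mathrm{i}\varphi_{d-1}X}$, then $\mathcal{C}$, and so on, ending with $\mathcal{C}$ and $e^{\mathrm{i}\varphi_0X}$; that is $$\mathcal{U}(\mathcal{H},\Phi)=(e^{\mathrm{i}\varphi_0X}\otimes I)\prod_{j=1}^d\left(\mathcal{C}\,(e^{\mathrm{i}\varphi_jX}\otimes I)\right).$$ Functions of the Hermitian operator $\mathcal{H}$ are defined by the spectral functional calculus. *)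

(* Defs.v *)
From mathcomp Require Import all_boot all_order all_algebra.
From mathcomp Require Import spectral sesquilinear.
From mathcomp Require character.
From mathcomp Require Import complex.
From mathcomp Require Import reals trigo.

Set Implicit Arguments.
Unset Strict Implicit.
Unset Printing Implicit Defensive.

Import Order.TTheory GRing.Theory Num.Theory.
Local Open Scope ring_scope.
Local Open Scope sesquilinear_scope.
Local Open Scope complex_scope.

(* In A ⊗ B the row (resp. column) index of A is the more significant one. *)
Notation "A ⊗ B" := (@character.tprod _ _ _ A _ _ B)
  (at level 40, left associativity) : ring_scope.

Section MatrixFunctions.
Variables (R : realType) (n : nat).
Implicit Types A B : 'M[R[i]]_n.

(* Spectral functional calculus.  It is meant for Hermitian A, for which
   A = V^-1 diag(s) V with V := spectralmx A unitary and s := spectral_diag A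
   real, so that complex.Re only changes the type of the eigenvalues. *)
Definition mxfun (f : R -> R[i]) A : 'M[R[i]]_n :=
  invmx (spectralmx A)
  *m diag_mx (map_mx (fun z => f (complex.Re z)) (spectral_diag A))
  *m spectralmx A.

Definition mxfunR (f : R -> R) A : 'M[R[i]]_n := mxfun (fun t => (f t)%:C) A.

(* e^{iA} for Hermitian A *)
Definition mxexpi A : 'M[R[i]]_n := mxfun (fun t => cos t +i* sin t) A.

(* <psi| A |psi> *)
Definition expval A (psi : 'cV[R[i]]_n) : R[i] := (psi ^t* *m A *m psi) 0 0.

Definition posdefmx A : Prop :=
  A \is hermsymmx /\ forall x : 'cV[R[i]]_n, x != 0 -> 0 < expval A x.

(* the strict Loewner order *)
Definition loewner_lt A B : Prop := posdefmx (B - A).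

Definition l2norm (psi : 'cV[R[i]]_n) : R[i] := sqrtC (\sum_i `|psi i 0| ^+ 2).

End MatrixFunctions.

Section QSP.
Variable R : realType.
Local Notation C := R[i].

Definition mx2 (a b c d : C) : 'M[C]_2 :=
  \matrix_(i, j) if i == 0 then (if j == 0 then a else b)
                 else (if j == 0 then c else d).

Definition pauliX : 'M[C]_2 := mx2 0 1 1 0.
Definition pauliZ : 'M[C]_2 := mx2 1 0 0 (-1).

Definition expiX (phi : R) : 'M[C]_2 := mxexpi (phi%:C *: pauliX).
Definition expiZ (theta : R) : 'M[C]_2 := mxexpi (theta%:C *: pauliZ).

(* The phase factor varphi_j is Phi 0 j; with j : 'I_d, lift ord0 j is j + 1. *)
Definition qsp (d : nat) (theta : R) (Phi : 'rV[R]_d.+1) : 'M[C]_2 :=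
  expiX (Phi 0 ord0)
  *m \prod_(j < d) (expiZ theta *m expiX (Phi 0 (lift ord0 j))).

(* rev_ord j is d - j *)
Definition Zsymmetric (d : nat) (Phi : 'rV[R]_d.+1) : Prop :=
  Phi 0 ord_max = Phi 0 ord0 + pi / 2 /\
  forall j : 'I_d.+1, (1 <= j <= d - 1)%N -> Phi 0 j = Phi 0 (rev_ord j).

Definition ket0 : 'cV[C]_2 := delta_mx 0 0.
Definition ket1 : 'cV[C]_2 := delta_mx 1 0.
Definition ketplus : 'cV[C]_2 := (sqrtC 2)^-1 *: (ket0 + ket1).

Section Circuit.
Variable n : nat.
Implicit Type H : 'M[C]_(2 ^ n).

Definition ctrl_evolution H : 'M[C]_(2 * 2 ^ n) :=
  (ket0 *m ket0 ^t*) ⊗ (1%:M : 'M[C]_(2 ^ n))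
  + (ket1 *m ket1 ^t*) ⊗ mxexpi (- H).

Definition on_ancilla (A : 'M[C]_2) : 'M[C]_(2 * 2 ^ n) :=
  A ⊗ (1%:M : 'M[C]_(2 ^ n)).

Definition circuit (d : nat) H (Phi : 'rV[R]_d.+1) : 'M[C]_(2 * 2 ^ n) :=
  on_ancilla (expiX (Phi 0 ord0))
  *m \prod_(j < d)
       (ctrl_evolution H *m on_ancilla (expiX (Phi 0 (lift ord0 j)))).

(* || (<a| ⊗ I) Psi ||_2 ^ 2 *)
Definition ancilla_prob (a : 'cV[C]_2) (Psi : 'cV[C]_(2 * 2 ^ n)) : C :=
  l2norm ((a ^t* ⊗ (1%:M : 'M[C]_(2 ^ n))) *m Psi) ^+ 2.

End Circuit.
End QSP.

(* Main.v *)
(* If H e = h e, then on C^2 (x) e the controlled evolution acts as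
   diag(1, e^{-ih}) = e^{-ih/2} e^{i(h/2)Z}, so the circuit acts as
   e^{-idh/2} Q(h/2, Phi).  Expanding psi in an orthonormal eigenbasis of H, the
   phases disappear from the squared moduli and each probability is the average
   of a one-qubit probability over the weights |<e, psi>|^2.  Unitarity of
   Q(h/2, Phi), i.e. u^2 + sin^2 w^2 + v^2 = 1, gives
   |u + sin w + iv|^2 / 2 = 1/2 + sin u w. *)

Require Import Defs.
From mathcomp Require Import all_boot all_order all_algebra.
From mathcomp Require Import spectral sesquilinear complex reals trigo.
From mathcomp Require Import ring.
Set Implicit Arguments.
Unset Strict Implicit.
Unset Printing Implicit Defensive.
Import Order.TTheory GRing.Theory Num.Theory.
Local Open Scope ring_scope.
Local Open Scope complex_scope.
Local Open Scope sesquilinear_scope.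

(** * Bilinearity of the Kronecker product *)

Section TensorProduct.
Variable F : fieldType.

(** The product is built by recursion on the rows of its left factor, so the induction splits off
    the top row of both [A] and [A']. *)
Lemma tprod_linearl (m1 n1 m2 n2 : nat) (k : F) (A A' : 'M[F]_(m1, n1))
    (B : 'M[F]_(m2, n2)) : (k *: A + A') ⊗ B = k *: (A ⊗ B) + A' ⊗ B.
Proof.
elim: m1 A A' => [|m1 IH] A A' /=; first by rewrite scaler0 add0r.
have -> : usubmx (k *: A + A' : 'M_(1 + m1, n1)) =
    k *: usubmx (A : 'M_(1 + m1, n1)) + usubmx (A' : 'M_(1 + m1, n1)).
  by apply/matrixP => i j; rewrite !mxE.
have -> : dsubmx (k *: A + A' : 'M_(1 + m1, n1)) =
    k *: dsubmx (A : 'M_(1 + m1, n1)) + dsubmx (A' : 'M_(1 + m1, n1)).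
  by apply/matrixP => i j; rewrite !mxE.
rewrite IH -!character.trowbE character.trowb_is_linear.
by rewrite scale_col_mx add_col_mx.
Qed.

Lemma tprod_linearr (m1 n1 m2 n2 : nat) (k : F) (A : 'M[F]_(m1, n1))
    (B B' : 'M[F]_(m2, n2)) : A ⊗ (k *: B + B') = k *: (A ⊗ B) + A ⊗ B'.
Proof.
elim: m1 A => [|m1 IH] A /=; first by rewrite scaler0 add0r.
by rewrite IH character.trow_is_linear scale_col_mx add_col_mx.
Qed.

Lemma tprodDl (m1 n1 m2 n2 : nat) (A A' : 'M[F]_(m1, n1))
    (B : 'M[F]_(m2, n2)) : (A + A') ⊗ B = A ⊗ B + A' ⊗ B.
Proof. by have := tprod_linearl 1 A A' B; rewrite !scale1r. Qed.

Lemma tprodDr (m1 n1 m2 n2 : nat) (A : 'M[F]_(m1, n1))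
    (B B' : 'M[F]_(m2, n2)) : A ⊗ (B + B') = A ⊗ B + A ⊗ B'.
Proof. by have := tprod_linearr 1 A B B'; rewrite !scale1r. Qed.

Lemma tprod0l (m1 n1 m2 n2 : nat) (B : 'M[F]_(m2, n2)) :
  (0 : 'M[F]_(m1, n1)) ⊗ B = 0.
Proof. by apply: (addrI (0 ⊗ B)); rewrite -tprodDl !addr0. Qed.

Lemma tprod0r (m1 n1 m2 n2 : nat) (A : 'M[F]_(m1, n1)) :
  A ⊗ (0 : 'M[F]_(m2, n2)) = 0.
Proof. by apply: (addrI (A ⊗ 0)); rewrite -tprodDr !addr0. Qed.

Lemma tprodZl (m1 n1 m2 n2 : nat) (k : F) (A : 'M[F]_(m1, n1))
    (B : 'M[F]_(m2, n2)) : (k *: A) ⊗ B = k *: (A ⊗ B).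
Proof. by have := tprod_linearl k A 0 B; rewrite tprod0l !addr0. Qed.

Lemma tprodZr (m1 n1 m2 n2 : nat) (k : F) (A : 'M[F]_(m1, n1))
    (B : 'M[F]_(m2, n2)) : A ⊗ (k *: B) = k *: (A ⊗ B).
Proof. by have := tprod_linearr k A B 0; rewrite tprod0r !addr0. Qed.

Lemma tprod_sumr (m1 n1 m2 n2 : nat) (A : 'M[F]_(m1, n1)) (I : Type)
    (r : seq I) (B : I -> 'M[F]_(m2, n2)) :
  A ⊗ (\sum_(i <- r) B i) = \sum_(i <- r) A ⊗ B i.
Proof.
apply: (big_morph (fun B : 'M[F]_(m2, n2) => A ⊗ B)) => [B1 B2|].
  exact: tprodDr.
exact: tprod0r.
Qed.

End TensorProduct.

(** * Matrices diagonalized by a unitary *)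

Section UnitaryDiagonal.
Variables (C : numClosedFieldType) (n : nat).
Implicit Types (A W : 'M[C]_n) (l m : 'rV[C]_n).

(** The eigenvectors are the columns of [W]; the matrix [spectralmx A] corresponds to [W ^t*]. *)
Definition udiag W l : 'M[C]_n := W *m diag_mx l *m W ^t*.

Lemma normal_udiag W l : W \is unitarymx -> udiag W l \is normalmx.
Proof.
move=> Wu; apply/orthomx_spectral_subproof.
exists (W ^t*, l) => /=; first by rewrite trmxC_unitary.
by rewrite /udiag invmx_unitary ?trmxC_unitary // trmxCK.
Qed.

Lemma invmx_diag_udiag W l : W \is unitarymx ->
  invmx W *m diag_mx l *m W = udiag (W ^t*) l.
Proof. by move=> Wu; rewrite /udiag trmxCK invmx_unitary. Qed.

Lemma normal_udiagP A :
  A \is normalmx -> exists2 W, W \is unitarymx & exists l, A = udiag W l.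
Proof.
move=> /orthomx_spectralP; have := spectral_unitarymx A.
move: (spectralmx A) (spectral_diag A) => V D Vu ->.
exists (V ^t*); first by rewrite trmxC_unitary.
by exists D; rewrite invmx_diag_udiag.
Qed.

Lemma udiagZ k W l : k *: udiag W l = udiag W (k *: l).
Proof. by rewrite /udiag linearZ /= -scalemxAr -scalemxAl. Qed.

Lemma mul_udiag W l m : W \is unitarymx ->
  udiag W l *m udiag W m = udiag W (\row_j (l 0 j * m 0 j)).
Proof.
move=> /unitarymxP/mulmx1C WCW.
rewrite /udiag -!mulmxA [W ^t* *m (W *m _)]mulmxA WCW mul1mx.
by rewrite [diag_mx l *m _]mulmxA mulmx_diag.
Qed.

Lemma sum_sqr_norm_mul (x : 'cV[C]_n) :
  \sum_i `|x i 0| ^+ 2 = (x ^t* *m x) 0 0.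
Proof. by rewrite mxE; apply: eq_bigr => i _; rewrite !mxE mulrC -normCK. Qed.

Lemma sum_sqr_norm_unitary W (x : 'cV[C]_n) : W \is unitarymx ->
  \sum_i `|(W *m x) i 0| ^+ 2 = \sum_i `|x i 0| ^+ 2.
Proof.
move=> /unitarymxP/mulmx1C WCW.
by rewrite !sum_sqr_norm_mul trmx_mul map_mxM mulmxA -[_ *m W]mulmxA WCW mulmx1.
Qed.

Lemma form_udiag W l (x : 'cV[C]_n) :
  (x ^t* *m udiag W l *m x) 0 0 = \sum_j l 0 j * `|(W ^t* *m x) j 0| ^+ 2.
Proof.
have -> : x ^t* *m udiag W l *m x =
    (W ^t* *m x) ^t* *m diag_mx l *m (W ^t* *m x).
  by rewrite /udiag trmx_mul map_mxM trmxCK !mulmxA.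
move: (W ^t* *m x) => c; rewrite mul_mx_diag mxE; apply: eq_bigr => j _.
by rewrite !mxE normCK mulrAC mulrC [_^* * _]mulrC.
Qed.

Lemma unitary_udiag W l : W \is unitarymx -> (forall j, `|l 0 j| = 1) ->
  udiag W l \is unitarymx.
Proof.
move=> Wu l1; apply: mul_unitarymx; last by rewrite trmxC_unitary.
apply: mul_unitarymx => //; apply/unitarymxP.
rewrite tr_diag_mx map_diag_mx mulmx_diag -diag_const_mx.
by congr diag_mx; apply/rowP => i; rewrite !mxE -normCK l1 expr1n.
Qed.

End UnitaryDiagonal.

(** * Independence of the functional calculus from the eigenbasis *)

Section SpectralCalculus.
Variables (R : realType) (n : nat).
Local Notation C := R[i].
Implicit Types (A W : 'M[C]_n) (l m : 'rV[C]_n) (f : R -> C).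

Lemma normc_expi (t : R) : `|cos t +i* sin t| = 1 :> C.
Proof. by rewrite normc_def /= cos2Dsin2 sqrtr1 rmorph1. Qed.

(* mxfun uses one particular eigenbasis V; V *m W intertwines the two diagonal
   forms, hence also their images under f. *)
Lemma mxfun_udiag f W l : W \is unitarymx ->
  mxfun f (udiag W l) = udiag W (map_mx (fun z => f (complex.Re z)) l).
Proof.
move=> Wu; rewrite /mxfun [RHS]/udiag; set A := udiag W l.
have AE : A = W *m diag_mx l *m W ^t* by [].
have WWC : W *m W ^t* = 1%:M by apply/unitarymxP.
have WCW : W ^t* *m W = 1%:M by apply: mulmx1C.
have /orthomx_spectralP AV : A \is normalmx by apply: normal_udiag.
have VV : spectralmx A *m invmx (spectralmx A) = 1%:M.
  by rewrite mulmxV ?spectral_unit.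
move: (spectralmx A) (spectral_diag A) (invmx _) AV VV => V D V' AV VV.
clearbody A.
have VVV := mulmx1C VV.
have DT : diag_mx D *m (V *m W) = V *m W *m diag_mx l.
  transitivity (V *m A *m W); first by rewrite AV !mulmxA VV mul1mx.
  by rewrite AE -!mulmxA WCW mulmx1.
have fDT : diag_mx (map_mx (fun z => f (complex.Re z)) D) *m (V *m W) =
    V *m W *m diag_mx (map_mx (fun z => f (complex.Re z)) l).
  (* With [T := V *m W], entry [(i, j)] of [DT] says that [D 0 i] and [l 0 j] agree wherever [T i j]
     is nonzero, so their images under [f] agree there; elsewhere both sides vanish. *)
  apply/matrixP => i j; have := congr1 (fun M : 'M_n => M i j) DT.
  rewrite !mul_diag_mx !mul_mx_diag; move: (V *m W) => T; rewrite !mxE mulrC.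
  have [->|t0] := eqVneq (T i j) 0; first by rewrite !mul0r mulr0.
  by move/(mulfI t0) => ->; rewrite mulrC.
move: (diag_mx (map_mx _ D)) (diag_mx (map_mx _ l)) fDT => fD fl fDT.
rewrite -[LHS]mulmxA.
have -> : fD *m V = V *m W *m fl *m W ^t* by rewrite -fDT -!mulmxA WWC mulmx1.
by rewrite !mulmxA VVV mul1mx.
Qed.

Lemma l2norm_sqr (N : nat) (x : 'cV[C]_N) :
  l2norm x ^+ 2 = \sum_i `|x i 0| ^+ 2.
Proof. by rewrite sqrtCK. Qed.

Lemma expval_udiag W l (psi : 'cV[C]_n) :
  expval (udiag W l) psi = \sum_j l 0 j * `|(W ^t* *m psi) j 0| ^+ 2.
Proof. exact: form_udiag. Qed.

(** Cosine and sine are evaluated at real parts of spectral entries, so the diagonal entries have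
    modulus one. *)
Lemma mxexpi_unitary A : mxexpi A \is unitarymx.
Proof.
rewrite /mxexpi /mxfun invmx_diag_udiag ?spectral_unitarymx //.
apply: unitary_udiag => [|j]; first by rewrite trmxC_unitary spectral_unitarymx.
by rewrite mxE; exact: normc_expi.
Qed.

End SpectralCalculus.

Lemma udiag_eigen (C : numClosedFieldType) (n : nat) (W : 'M[C]_n)
    (l : 'rV[C]_n) (j : 'I_n) : W \is unitarymx ->
  udiag W l *m (W *m delta_mx j 0) = l 0 j *: (W *m delta_mx j (0 : 'I_1)).
Proof.
move=> /unitarymxP/mulmx1C WCW.
rewrite /udiag -!mulmxA [W ^t* *m (W *m _)]mulmxA WCW mul1mx scalemxAr.
congr (_ *m _); apply/matrixP => i k; rewrite mul_diag_mx !mxE.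
by case: eqP => [->|]; rewrite ?mulr0.
Qed.

Lemma sum_sqr_norm_tprod (C : numClosedFieldType) (N : nat) (x : 'M[C]_1)
    (y : 'cV[C]_N) :
  \sum_i `|(x ⊗ y) i 0| ^+ 2 = `|x 0 0| ^+ 2 * \sum_i `|y i 0| ^+ 2.
Proof.
(* The row count [1 * N] computes to [N + 0], hence the empty second block. *)
rewrite mulr_sumr (@big_split_ord _ _ _ N 0) /= big_ord0 addr0.
apply: eq_bigr => i _; rewrite col_mxEu /= [X in `|X|]mxE.
case: splitP => [k _|[] //]; rewrite [k]ord1 !mxE normrM exprMn.
by congr (`|x _ _| ^+ 2 * _); apply/val_inj.
Qed.

(** * One-qubit gates and their action on tensor products *)

Section TwoByTwo.
Variable R : realType.
Local Notation C := R[i].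

Definition expi (t : R) : C := cos t +i* sin t.

Lemma expiD (s t : R) : expi (s + t) = expi s * expi t.
Proof. by rewrite /expi cosD sinD [sin s * _ + _]addrC. Qed.

(** Pauli Z is already diagonal, so [mxfun_udiag] applies with the identity as eigenbasis. *)
Lemma expiZE (t : R) : expiZ t = mx2 (expi t) 0 0 (expi (- t)).
Proof.
have u1 : (1%:M : 'M[C]_2) \is unitarymx.
  by apply/unitarymxP; rewrite trmx1 map_mx1 mulmx1.
pose l : 'rV[C]_2 := \row_j (if j == 0 then t%:C else - t%:C).
have ZE : t%:C *: pauliZ R = udiag 1%:M l.
  rewrite /udiag mul1mx trmx1 map_mx1 mulmx1.
  apply/matrixP => i j; rewrite !mxE.
  by case: i => [[|[|i]] Hi] //; case: j => [[|[|j]] Hj] //=;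
    rewrite ?mulr1 ?mulr0 ?mulrN1 ?mulr1n ?mulr0n.
rewrite /expiZ /mxexpi ZE (mxfun_udiag _ _ u1).
rewrite /udiag mul1mx trmx1 map_mx1 mulmx1.
apply/matrixP => i j; rewrite !mxE.
by case: i => [[|[|i]] Hi] //; case: j => [[|[|j]] Hj].
Qed.

Lemma qsp_unitary (d : nat) (t : R) (Phi : 'rV[R]_d.+1) :
  qsp t Phi \is unitarymx.
Proof.
apply: mul_unitarymx; first exact: mxexpi_unitary.
apply: (big_ind (fun M : 'M[C]_2 => M \is unitarymx)) => [|A B|j _].
- by apply/unitarymxP; rewrite trmx1 map_mx1 mulmx1.
- exact: mul_unitarymx.
- by apply: mul_unitarymx; exact: mxexpi_unitary.
Qed.

End TwoByTwo.

Lemma ket0_proj (R : realType) : ket0 R *m (ket0 R) ^t* = mx2 1 0 0 0.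
Proof.
apply/matrixP => i j; rewrite mxE big_ord1 !mxE.
by case: i => [[|[|i]] Hi] //; case: j => [[|[|j]] Hj] //=;
  rewrite ?conjC0 ?conjC1 ?mulr1 ?mulr0.
Qed.

Lemma ket1_proj (R : realType) : ket1 R *m (ket1 R) ^t* = mx2 0 0 0 1.
Proof.
apply/matrixP => i j; rewrite mxE big_ord1 !mxE.
by case: i => [[|[|i]] Hi] //; case: j => [[|[|j]] Hj] //=;
  rewrite ?conjC0 ?conjC1 ?mulr1 ?mulr0.
Qed.

(** The ancilla phases 0 and -2t are centred at their mean -t, which becomes a global phase. Here t
    is half an eigenvalue, whence the form [t + t]. *)
Lemma ctrl_phase (R : realType) (t : R) :
  mx2 1 0 0 0 + expi (- (t + t)) *: mx2 0 0 0 1 = expi (- t) *: expiZ t.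
Proof.
rewrite expiZE; apply/matrixP => i j; rewrite !mxE.
have e0 : expi (0 : R) = 1 by rewrite /expi cos0 sin0.
by case: i => [[|[|i]] Hi] //; case: j => [[|[|j]] Hj] //=;
 rewrite ?mulr1 ?mulr0 ?addr0 ?add0r -?expiD ?addNr ?e0 ?opprD.
Qed.

(** When the columns of [B] lie in one eigenspace of [E], the system only contributes the scalar
    [c], which moves across the tensor product onto the ancilla block. *)
Lemma block_tprod (F : fieldType) (N m p : nat) (P Q : 'M[F]_2)
    (E : 'M[F]_N) (c : F) (A : 'M[F]_(2, m)) (B : 'M[F]_(N, p)) : E *m B = c *: B ->
  (P ⊗ (1%:M : 'M_N) + Q ⊗ E) *m (A ⊗ B) = ((P + c *: Q) *m A) ⊗ B.
Proof.
move=> EB; rewrite [LHS]mulmxDl -!character.tprodE mul1mx EB.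
by rewrite tprodZr -tprodZl -tprodDl [in RHS]mulmxDl -scalemxAl.
Qed.

(** Each factor returns a tensor with the same [B], so the factors can be applied in turn, each
    adding one [c]; the assumption ranges over all [A] because the ancilla part changes every
    time. *)
Lemma prod_block_tprod (F : fieldType) (N m p d : nat)
    (T : 'I_d -> 'M[F]_(2 * N)) (G : 'I_d -> 'M[F]_2) (c : F) (B : 'M[F]_(N, p)) :
  (forall j m (A : 'M_(2, m)), T j *m (A ⊗ B) = (c *: (G j *m A)) ⊗ B) ->
  forall A : 'M_(2, m),
  (\prod_j T j) *m (A ⊗ B) = (c ^+ d *: ((\prod_j G j) *m A)) ⊗ B.
Proof.
move=> TB A; elim: d T G TB => [|d IH] T G TB.
  by rewrite !big_ord0 expr0 scale1r !mul1mx.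
rewrite !big_ord_recl -!mulmxA (IH _ (fun j => G (lift ord0 j))) => [|j k A'];
  last exact: TB.
by rewrite TB -scalemxAr scalerA -exprS mulmxA.
Qed.

(** * The circuit on eigenvectors of the Hamiltonian *)

Section CircuitAction.
Variables (R : realType) (n : nat).
Local Notation C := R[i].
Implicit Type H : 'M[C]_(2 ^ n).

Lemma ctrl_evolution_tprod H (t : R) (m p : nat) (A : 'M[C]_(2, m))
    (B : 'M[C]_(2 ^ n, p)) : mxexpi (- H) *m B = expi (- (t + t)) *: B ->
  ctrl_evolution H *m (A ⊗ B) = (expi (- t) *: (expiZ t *m A)) ⊗ B.
Proof.
rewrite /ctrl_evolution ket0_proj ket1_proj scalemxAl -ctrl_phase.
exact: block_tprod.
Qed.

Lemma on_ancilla_tprod (m p : nat) (G : 'M[C]_2) (A : 'M[C]_(2, m))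
    (B : 'M[C]_(2 ^ n, p)) : on_ancilla n G *m (A ⊗ B) = (G *m A) ⊗ B.
Proof. by rewrite /on_ancilla -character.tprodE mul1mx. Qed.

Lemma circuit_tprod (d : nat) H (Phi : 'rV[R]_d.+1) (t : R) (m p : nat)
    (A : 'M[C]_(2, m)) (B : 'M[C]_(2 ^ n, p)) :
  mxexpi (- H) *m B = expi (- (t + t)) *: B ->
  circuit H Phi *m (A ⊗ B) = (expi (- t) ^+ d *: (qsp t Phi *m A)) ⊗ B.
Proof.
move=> HB; rewrite /circuit /qsp -[LHS]mulmxA.
rewrite (@prod_block_tprod _ _ _ _ _ _
  (fun j => expiZ t *m expiX (Phi 0 (lift ord0 j))) (expi (- t))).
  by rewrite on_ancilla_tprod -scalemxAr mulmxA.
move=> j m' A'; rewrite -[LHS]mulmxA on_ancilla_tprod.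
by rewrite (ctrl_evolution_tprod _ HB) mulmxA.
Qed.

(** Eigenvectors of [H] evolve independently and stay orthonormal, so the squared norm after
    projection has no cross terms. *)
Lemma ancilla_prob_circuit (d : nat) H (Phi : 'rV[R]_d.+1)
    (W : 'M[C]_(2 ^ n)) (l : 'rV[C]_(2 ^ n)) (a b : 'cV[C]_2)
    (psi : 'cV[C]_(2 ^ n)) : W \is unitarymx -> H = udiag W l ->
  ancilla_prob a (circuit H Phi *m (b ⊗ psi)) =
  \sum_j `|(a ^t* *m (qsp (complex.Re (l 0 j) / 2) Phi *m b)) 0 0| ^+ 2
         * `|(W ^t* *m psi) j 0| ^+ 2.
Proof.
move=> Wu HW; set c := W ^t* *m psi.
pose t j := complex.Re (l 0 j) / 2.
pose g j := (a ^t* *m (qsp (t j) Phi *m b)) 0 0.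
(* Eigenbasis coordinates of the unnormalized system state left once the ancilla is projected onto
   [a]. *)
pose z : 'cV[C]_(2 ^ n) := \col_j (expi (- t j) ^+ d * g j * c j 0).
pose e j : 'cV[C]_(2 ^ n) := W *m delta_mx j 0.
have sumE (y : 'cV[C]_(2 ^ n)) : W *m y = \sum_j y j 0 *: e j.
  rewrite [in LHS](matrix_sum_delta y) mulmx_sumr; apply: eq_bigr => j _.
  by rewrite big_ord1 -scalemxAr.
have psiE : psi = \sum_j c j 0 *: e j.
  by rewrite -sumE /c mulmxA (unitarymxP Wu) mul1mx.
have He j : mxexpi (- H) *m e j = expi (- (t j + t j)) *: e j.
  have -> : - H = udiag W (- l) by rewrite HW -scaleN1r udiagZ scaleN1r.
  rewrite /mxexpi (mxfun_udiag _ _ Wu) (udiag_eigen _ _ Wu) !mxE.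
  congr (expi _ *: _).
  by rewrite raddfN /= /t -splitr.
(* The bra reduces the ancilla to a factor of size one, and the scalar [g j] it produces is absorbed
   into [z]. *)
have key : (a ^t* ⊗ (1%:M : 'M[C]_(2 ^ n))) *m (circuit H Phi *m (b ⊗ psi)) =
    1%:M ⊗ (W *m z).
  rewrite psiE tprod_sumr !mulmx_sumr sumE tprod_sumr; apply: eq_bigr => j _.
  rewrite tprodZr -!scalemxAr (circuit_tprod _ _ (He j)).
  rewrite -[_ *m (_ ⊗ _)]character.tprodE mul1mx -scalemxAr tprodZl.
  rewrite [_ *m (_ *m b)]mx11_scalar -/(g j) -scalemx1 tprodZl !scalerA.
  by rewrite tprodZr; congr (_ *: _); rewrite [RHS]mxE mulrC.
rewrite /ancilla_prob l2norm_sqr key.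
rewrite (sum_sqr_norm_tprod 1%:M (W *m z)) sum_sqr_norm_unitary //.
rewrite mxE normr1 expr1n mul1r; apply: eq_bigr => j _.
by rewrite mxE !normrM normrX normc_expi expr1n mul1r exprMn.
Qed.

End CircuitAction.

(** * Measurement amplitudes of a single qubit *)

Section Amplitudes.
Variable R : realType.
Local Notation C := R[i].

Lemma ket0_amplitude (Q : 'M[C]_2) :
  ((ket0 R) ^t* *m (Q *m ket0 R)) 0 0 = Q 0 0.
Proof.
rewrite mxE !big_ord_recl big_ord0 !mxE !big_ord_recl !big_ord0 !mxE /=.
by rewrite conjC0 conjC1 !(mul0r, mul1r, mulr0, mulr1, addr0).
Qed.

Lemma ketplus_amplitude (Q : 'M[C]_2) :
  `|((ketplus R) ^t* *m (Q *m ket0 R)) 0 0| ^+ 2 =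
  2^-1 * `|Q 0 0 + Q 1 0| ^+ 2.
Proof.
have -> : ((ketplus R) ^t* *m (Q *m ket0 R)) 0 0 =
    ((sqrtC 2)^-1)^* * (Q 0 0 + Q 1 0).
  rewrite mxE !big_ord_recl big_ord0 !mxE !big_ord_recl !big_ord0 !mxE /=.
  rewrite !(mulr0, mulr1, addr0, add0r) mulrDr.
  by congr (_ * Q _ _ + _ * Q _ _); apply/val_inj.
by rewrite normrM norm_conjC normfV exprMn exprVn -normrX sqrtCK normr_nat.
Qed.

(** Applied to the QSP matrix, this yields the normalization of [u], [v] and [w]. *)
Lemma mx2_unitary_row0 (a b c d : C) :
  mx2 a b c d \is unitarymx -> `|a| ^+ 2 + `|b| ^+ 2 = 1.
Proof.
move=> /unitarymxP/(congr1 (fun M : 'M_2 => M 0 0)).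
by rewrite mxE !big_ord_recl big_ord0 !mxE /= addr0 -!normCK.
Qed.

End Amplitudes.

Theorem theorem14 (R : realType) (d : nat) (hd : (1 <= d)%N)
  (Phi : 'rV[R]_d.+1) (hPhi : Zsymmetric Phi)
  (u v w : {poly R})
  (huvw : forall theta : R,
     qsp theta Phi =
     mx2 (u.[cos theta])%:C
         (- (sin theta * w.[cos theta]) +i* v.[cos theta])
         (sin theta * w.[cos theta] +i* v.[cos theta])
         (u.[cos theta])%:C)
  (n : nat) (H : 'M[R[i]]_(2 ^ n)) (hH : H \is hermsymmx)
  (hH0 : loewner_lt 0 H) (hHpi : loewner_lt H ((pi / 2)%:C%:M))
  (psi : 'cV[R[i]]_(2 ^ n)) (hpsi : l2norm psi = 1) :
  let out : 'cV[R[i]]_(2 * 2 ^ n) := circuit H Phi *m (ket0 R ⊗ psi) in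
  let cosH2 := mxfunR cos (2^-1 *: H) in
  let sinH2 := mxfunR sin (2^-1 *: H) in
  ancilla_prob (ket0 R) out = expval (mxfunR (fun t => u.[t] ^+ 2) cosH2) psi
  /\
  ancilla_prob (ketplus R) out =
    2^-1 + expval (sinH2 *m mxfunR (fun t => u.[t]) cosH2
                         *m mxfunR (fun t => w.[t]) cosH2) psi.
Proof.
move=> out cosH2 sinH2.
have [W Wu [l HW]] := normal_udiagP (hermitian_normalmx hH).
pose t j := complex.Re (l 0 j) / 2.
have funH2 f : mxfunR f (2^-1 *: H) = udiag W (\row_j (f (t j))%:C).
  rewrite HW udiagZ /mxfunR (mxfun_udiag _ _ Wu); congr udiag.
  apply/rowP => j; rewrite !mxE /t.
  (* The complex scalar [2^-1] is exhibited as an embedded real, so that it simply halves the real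
     part of the eigenvalue. *)
  rewrite -(rmorph_nat (real_complex R) 2) -fmorphV; case: (l 0 j) => x y /=.
  by rewrite mul0r subr0 mulrC.
have funcosH2 f : mxfunR f cosH2 = udiag W (\row_j (f (cos (t j)))%:C).
  rewrite /cosH2 funH2 /mxfunR (mxfun_udiag _ _ Wu); congr udiag.
  by apply/rowP => j; rewrite !mxE.
have sum_c : \sum_j `|(W ^t* *m psi) j 0| ^+ 2 = 1.
  by rewrite sum_sqr_norm_unitary ?trmxC_unitary // -l2norm_sqr hpsi expr1n.
split.
  rewrite (ancilla_prob_circuit _ _ _ _ Wu HW) funcosH2 expval_udiag.
  apply: eq_bigr => j _; congr (_ * _).
  (* The amplitude is an embedded real, so its squared modulus is its square. *)
  by rewrite ket0_amplitude huvw !mxE /= -add_Re2_Im2 /= expr0n addr0.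
rewrite (ancilla_prob_circuit _ _ _ _ Wu HW) funcosH2 funcosH2 /sinH2 funH2.
(* Spreading the constant over the weights, which sum to one, lets the identity be checked one
   eigenvalue at a time. *)
have half : \sum_j 2^-1 * `|(W ^t* *m psi) j 0| ^+ 2 = 2^-1.
  by rewrite -mulr_sumr sum_c mulr1.
rewrite !(mul_udiag _ _ Wu) expval_udiag -{1}half.
rewrite -big_split; apply: eq_bigr => j _ /=; rewrite -mulrDl; congr (_ * _).
have Qu := qsp_unitary (t j) Phi; rewrite huvw in Qu.
have := mx2_unitary_row0 Qu.
rewrite ketplus_amplitude huvw !mxE /= -/(t j) -!add_Re2_Im2 /=.
(* Normalization and goal are both brought down to identities between reals. *)
move/(congr1 (@complex.Re R)) => /= N.
rewrite -(rmorph_nat (real_complex R) 2) -fmorphV -!rmorphM -rmorphD.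
congr _%:C; move: N.
move: (u.[_]) (sin _) (w.[_]) (v.[_]) => x s y z N.
(* Expanding half of [(x + s * y) ^+ 2 + z ^+ 2] leaves the cross term [s * x * y] beside the left
   side of [N]; the [0 ^+ 2] in it is the imaginary part of the real diagonal entry. *)
transitivity
  (2^-1 * (x ^+ 2 + 0 ^+ 2 + ((- (s * y)) ^+ 2 + z ^+ 2)) + s * x * y).
  by field.
by rewrite N mulr1.
Qed.
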